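(* Let $R$ be a valuation ring and let $Q$ be its total quotient ring. Then $Q$ is self injective (i.e. injective as a $Q$-module) if and only if each singly projective $R$-module is finitely projective.
   Context: A valuation ring is a commutative ring $R$ (possibly with zero-divisors) whose set of ideals is totally ordered by inclusion. $Q=R_Z$ is the localization of $R$ at the prime ideal $Z$ consisting of the zero-divisors of $R$. An $R$-module $M$ is finitely projective (respectively singly projective) if, for any finitely generated (respectively cyclic) submodule $N$ of $M$, the inclusion map $N\to M$ factors through a free module. *)

(* Defs.v *)
From HB Require Import structures.
From mathcomp Require Import all_boot all_order all_algebra.
From mathcomp Require Import generic_quotient.
From mathcomp Require Import boolp ring.

Set Implicit Arguments.
Unset Strict Implicit.
Unset Printing Implicit Defensive.

Import GRing.Theory.

Local Open Scope ring_scope.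
Local Open Scope quotient_scope.

(* Submodules are the bundled boolean predicates [submodClosed M]; with the
   classical axioms of boolp, every submodule is of this form.  Ideals are the
   submodules of the regular module [R^o]. *)

Section Localization.

Variables (R : comNzRingType) (S : mulrClosed R).

Record loc_denom := LocDenom { loc_val : R; loc_valP : loc_val \in S }.
HB.instance Definition _ := [isSub for loc_val].
HB.instance Definition _ := [Choice of loc_denom by <:].

Definition loc_one : loc_denom := LocDenom (@rpred1 R S).
Definition loc_dmul (s t : loc_denom) : loc_denom :=
  LocDenom (@rpredM R S _ _ (loc_valP s) (loc_valP t)).

Definition loc_pair := (R * loc_denom)%type.
HB.instance Definition _ := Choice.on loc_pair.

(* [S^-1 R], possibly the zero ring.  The factor [w] is needed because [S] may contain zero-divisors. *)
Definition loc_equiv (x y : loc_pair) : bool :=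
  `[< exists2 w, w \in S & w * (x.1 * loc_val y.2) = w * (y.1 * loc_val x.2) >].

Lemma loc_equiv_refl : reflexive loc_equiv.
Proof. by move=> x; apply/asboolP; exists 1; rewrite ?rpred1. Qed.

Lemma loc_equiv_sym : symmetric loc_equiv.
Proof. by move=> x y; apply/asboolP/asboolP => -[w Sw e]; exists w. Qed.

Lemma loc_equiv_trans : transitive loc_equiv.
Proof.
move=> [b t] [a s] [c u] /asboolP[w Sw /= e] /asboolP[v Sv /= f].
apply/asboolP; exists (w * v * loc_val t) => /=.
  by rewrite !rpredM ?(loc_valP t).
transitivity (v * loc_val u * (w * (a * loc_val t))); first by ring.
rewrite e; transitivity (w * loc_val s * (v * (b * loc_val u))); first by ring.
by rewrite f; ring.
Qed.

Canonical loc_equivRel :=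
  EquivRel loc_equiv loc_equiv_refl loc_equiv_sym loc_equiv_trans.

Definition localization := {eq_quot loc_equiv}.
HB.instance Definition _ : EqQuotient _ loc_equiv localization :=
  EqQuotient.on localization.
HB.instance Definition _ := Choice.on localization.

Definition loc_frac (a : R) (s : loc_denom) : localization :=
  \pi_localization ((a, s) : loc_pair).

Lemma loc_fracP (a b : R) (s t : loc_denom) :
  (exists2 w, w \in S & w * (a * loc_val t) = w * (b * loc_val s)) <->
  loc_frac a s = loc_frac b t.
Proof.
split=> [h|/eqmodP/asboolP//].
by apply/eqmodP/asboolP.
Qed.

Lemma loc_fracW (P : localization -> Prop) :
  (forall a s, P (loc_frac a s)) -> forall x, P x.
Proof. by move=> h; elim/quotW => -[a s]; apply: h. Qed.

Definition loc_num (x : localization) : R := (repr x).1.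
Definition loc_den (x : localization) : loc_denom := (repr x).2.

Lemma loc_repr x : loc_frac (loc_num x) (loc_den x) = x.
Proof. by rewrite /loc_frac /loc_num /loc_den -surjective_pairing reprK. Qed.

Definition loc_add (x y : localization) : localization :=
  loc_frac (loc_num x * loc_val (loc_den y) + loc_num y * loc_val (loc_den x))
           (loc_dmul (loc_den x) (loc_den y)).
Definition loc_opp (x : localization) : localization :=
  loc_frac (- loc_num x) (loc_den x).
Definition loc_mul (x y : localization) : localization :=
  loc_frac (loc_num x * loc_num y) (loc_dmul (loc_den x) (loc_den y)).

Lemma loc_addE a s b t : loc_add (loc_frac a s) (loc_frac b t) =
  loc_frac (a * loc_val t + b * loc_val s) (loc_dmul s t).
Proof.
have /loc_fracP[w Sw e] := loc_repr (loc_frac a s).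
have /loc_fracP[v Sv f] := loc_repr (loc_frac b t).
apply/loc_fracP; exists (w * v); rewrite ?rpredM //=.
set a' := loc_num _ in e *; set s' := loc_val (loc_den _) in e *.
set b' := loc_num _ in f *; set t' := loc_val (loc_den _) in f *.
transitivity (v * t' * loc_val t * (w * (a' * loc_val s)) +
              w * s' * loc_val s * (v * (b' * loc_val t))); first by ring.
by rewrite e f; ring.
Qed.

Lemma loc_oppE a s : loc_opp (loc_frac a s) = loc_frac (- a) s.
Proof.
have /loc_fracP[w Sw e] := loc_repr (loc_frac a s).
by apply/loc_fracP; exists w; rewrite // !mulNr !mulrN e.
Qed.

Lemma loc_mulE a s b t : loc_mul (loc_frac a s) (loc_frac b t) =
  loc_frac (a * b) (loc_dmul s t).
Proof.
have /loc_fracP[w Sw e] := loc_repr (loc_frac a s).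
have /loc_fracP[v Sv f] := loc_repr (loc_frac b t).
apply/loc_fracP; exists (w * v); rewrite ?rpredM //=.
set a' := loc_num _ in e *; set s' := loc_val (loc_den _) in e *.
set b' := loc_num _ in f *; set t' := loc_val (loc_den _) in f *.
transitivity ((w * (a' * loc_val s)) * (v * (b' * loc_val t))); first by ring.
by rewrite e f; ring.
Qed.

Let loc_eq a b s t : a * loc_val t = b * loc_val s -> loc_frac a s = loc_frac b t.
Proof. by move=> e; apply/loc_fracP; exists 1; rewrite ?rpred1 ?e. Qed.

Lemma loc_addA : associative loc_add.
Proof.
elim/loc_fracW=> a s; elim/loc_fracW=> b t; elim/loc_fracW=> c u.
by rewrite !loc_addE; apply: loc_eq => /=; ring.
Qed.

Lemma loc_addC : commutative loc_add.
Proof.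
elim/loc_fracW=> a s; elim/loc_fracW=> b t.
by rewrite !loc_addE; apply: loc_eq => /=; ring.
Qed.

Lemma loc_add0 : left_id (loc_frac 0 loc_one) loc_add.
Proof.
by elim/loc_fracW=> a s; rewrite loc_addE; apply: loc_eq => /=; ring.
Qed.

Lemma loc_addN : left_inverse (loc_frac 0 loc_one) loc_opp loc_add.
Proof.
by elim/loc_fracW=> a s; rewrite loc_oppE loc_addE; apply: loc_eq => /=; ring.
Qed.

HB.instance Definition _ :=
  GRing.isZmodule.Build localization loc_addA loc_addC loc_add0 loc_addN.

Lemma loc_mulA : associative loc_mul.
Proof.
elim/loc_fracW=> a s; elim/loc_fracW=> b t; elim/loc_fracW=> c u.
by rewrite !loc_mulE; apply: loc_eq => /=; ring.
Qed.

Lemma loc_mulC : commutative loc_mul.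
Proof.
elim/loc_fracW=> a s; elim/loc_fracW=> b t.
by rewrite !loc_mulE; apply: loc_eq => /=; ring.
Qed.

Lemma loc_mul1 : left_id (loc_frac 1 loc_one) loc_mul.
Proof.
by elim/loc_fracW=> a s; rewrite loc_mulE; apply: loc_eq => /=; ring.
Qed.

Lemma loc_mulDl : left_distributive loc_mul loc_add.
Proof.
elim/loc_fracW=> a s; elim/loc_fracW=> b t; elim/loc_fracW=> c u.
by rewrite !(loc_addE, loc_mulE); apply: loc_eq => /=; ring.
Qed.

HB.instance Definition _ := GRing.Zmodule_isComPzRing.Build localization
  loc_mulA loc_mulC loc_mul1 loc_mulDl.

End Localization.

Section TotalQuotientRing.

Variable R : comNzRingType.

Definition zero_divisor (x : R) : Prop := exists2 y : R, y != 0 & x * y = 0.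

Definition regular_elt : {pred R} := fun x => `[< ~ zero_divisor x >].

Lemma regular_elt_mulr_closed : mulr_closed regular_elt.
Proof.
split=> [|x y /asboolP rx /asboolP ry]; apply/asboolP.
  by case=> y y0; rewrite mul1r => /eqP; rewrite (negPf y0).
case=> z z0 xyz; have [yz0|yz0] := eqVneq (y * z) 0.
  by apply: ry; exists z.
by apply: rx; exists (y * z); rewrite // mulrA.
Qed.

HB.instance Definition _ :=
  GRing.isMulClosed.Build R regular_elt regular_elt_mulr_closed.

(* [R_Z]: the denominators are the elements outside the set of
   zero-divisors. *)
Definition total_quotient_ring : comPzRingType := localization regular_elt.

End TotalQuotientRing.

Definition valuation_ring (R : comNzRingType) : Prop :=
  forall I J : submodClosed R^o, {subset I <= J} \/ {subset J <= I}.

Section Modules.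

Variable R : pzRingType.

Definition submod_of (M : lmodType R) (N : submodClosed M) := {x : M | x \in N}.
HB.instance Definition _ (M : lmodType R) (N : submodClosed M) :=
  SubChoice.on (submod_of N).
HB.instance Definition _ (M : lmodType R) (N : submodClosed M) :=
  [SubChoice_isSubLmodule of submod_of N by <:].

Definition finitely_generated (M : lmodType R) (N : submodClosed M) : Prop :=
  exists s : seq M, forall x : M,
    x \in N <-> exists c : 'I_(size s) -> R, x = \sum_i c i *: s`_i.

Definition cyclic_submod (M : lmodType R) (N : submodClosed M) : Prop :=
  exists m : M, forall x : M, x \in N <-> exists a : R, x = a *: m.

Definition basis (F : lmodType R) (B : F -> Prop) : Prop :=
  (forall x : F, exists (s : seq F) (c : F -> R),
      (forall b, b \in s -> B b) /\ x = \sum_(b <- s) c b *: b) /\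
  (forall (s : seq F) (c : F -> R),
      uniq s -> (forall b, b \in s -> B b) ->
      \sum_(b <- s) c b *: b = 0 -> forall b, b \in s -> c b = 0).

Definition free_module (F : lmodType R) : Prop :=
  exists B : F -> Prop, basis B.

Definition inclusion_factors_through_free
    (M : lmodType R) (N : submodClosed M) : Prop :=
  exists (F : lmodType R) (u : {linear submod_of N -> F}) (v : {linear F -> M}),
    free_module F /\ forall x : submod_of N, v (u x) = val x.

Definition finitely_projective (M : lmodType R) : Prop :=
  forall N : submodClosed M,
    finitely_generated N -> inclusion_factors_through_free N.

Definition singly_projective (M : lmodType R) : Prop :=
  forall N : submodClosed M,
    cyclic_submod N -> inclusion_factors_through_free N.

Definition injective_module (E : lmodType R) : Prop :=
  forall (A B : lmodType R) (i : {linear A -> B}) (f : {linear A -> E}),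
    injective i -> exists g : {linear B -> E}, forall a : A, g (i a) = f a.

Definition self_injective : Prop := injective_module R^o.

End Modules.

(* Main.v *)
Require Import Defs.
From HB Require Import structures.
From mathcomp Require Import all_boot all_order all_algebra.
From mathcomp Require Import generic_quotient ring_quotient.
From mathcomp Require Import boolp classical_sets functions ring.

(* Over a valuation ring [R], a module [M] is singly projective iff every [m] in [M]
   is [c m'] with [ann m = ann c] ([unit_content]).

   If [Q] is self-injective, it is injective over [R], and generators of a submodule
   are split off one at a time: among the generators, one can find [x2 = c2 m2] and
   an [R]-linear [pi : M -> Q] with [pi m2 = 1] and values in [R c2] on all
   generators.  Although [pi] need not map [M] into [R], [ker pi] is again singly
   projective and contains the residues [x - pi x m2] of the generators.

   Conversely, the injective hull of [R] (a maximal essential extension inside a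
   coinduced module [Hom_Z(R, D)], [D] divisible) is singly projective.  If it is
   finitely projective, the submodule spanned by [1] and by an element inducing a
   given homomorphism from an ideal embeds in a free module; comparing a coordinate
   at which [1] is regular shows that the homomorphism is multiplication by an
   element of [Q], and Baer's criterion applies. *)

Set Implicit Arguments.
Unset Strict Implicit.
Unset Printing Implicit Defensive.

Import Order.TTheory GRing.Theory Num.Theory.

Local Open Scope ring_scope.

(** * Baer's criterion *)


Definition is_submod (S : pzRingType) (B : lmodType S) (P : B -> Prop) : Prop :=
  P 0 /\ forall a x y, P x -> P y -> P (a *: x + y).

Section Submodules.

Variables (S : pzRingType) (B : lmodType S).
Implicit Types (P : B -> Prop) (x y : B).

Lemma is_submodD P x y : is_submod P -> P x -> P y -> P (x + y).
Proof. by case=> _ h px py; rewrite -[x]scale1r; apply: h. Qed.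

Lemma is_submodZ P a x : is_submod P -> P x -> P (a *: x).
Proof. by case=> p0 h px; rewrite -[_ *: _]addr0; apply: h. Qed.

Lemma is_submodN P x : is_submod P -> P x -> P (- x).
Proof. by move=> hP px; rewrite -scaleN1r; apply: is_submodZ. Qed.

Lemma is_submodB P x y : is_submod P -> P x -> P y -> P (x - y).
Proof. by move=> hP px py; apply: is_submodD => //; apply: is_submodN. Qed.

Definition submod_pred P of is_submod P : {pred B} := fun x => `[< P x >].

Lemma submod_predE P (hP : is_submod P) x : (x \in submod_pred hP) <-> P x.
Proof. by split=> [/asboolP//|?]; apply/asboolP. Qed.

Fact submod_pred_closed P (hP : is_submod P) : submod_closed (submod_pred hP).
Proof.
split=> [|a x y]; first by apply/submod_predE; case: hP.
by move=> /submod_predE px /submod_predE py; apply/submod_predE; case: hP => _; apply.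
Qed.

HB.instance Definition _ P (hP : is_submod P) :=
  GRing.isSubmodClosed.Build S B (submod_pred hP)
    (GRing.submod_closed_semi (submod_pred_closed hP)).


Lemma maximal_submod P0 (good : B -> Prop) :
  is_submod P0 -> (forall x, P0 x -> good x) ->
  exists P, [/\ is_submod P, forall x, P0 x -> P x, forall x, P x -> good x &
    forall y, (forall x r, P x -> good (x + r *: y)) -> P y].
Proof.
move=> sub0 good0.
pose ok (A : set B) := is_submod A /\ forall x, A x -> good x.
(* The sets [A] are tested through their union with [P0], so that the empty chain, whose union is
   empty, is harmless. *)
case: (@Zorn_bigcup B (fun A : set B => ok (A `|` P0)%classic)) => [F Fok Ftot|A [okA maxA]].
  set U := (_ `|` P0)%classic.
  have key x y : U x -> U y -> exists X : set B,
      [/\ ok X, forall z, X z -> U z, X x & X y].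
    have step (X Y : set B) : F X -> F Y -> exists2 Z : set B,
        F Z & (forall z, X z -> Z z) /\ (forall z, Y z -> Z z).
      by move=> FX FY; have [h|h] := Ftot X Y FX FY; [exists Y|exists X] => //; split.
    have wid (X : set B) : F X -> forall z, (X `|` P0)%classic z -> U z.
      by move=> FX z [Xz|]; [left; exists X|right].
    case=> [[X FX Xx]|P0x] [[Y FY Yy]|P0y].
    - have [Z FZ [XZ YZ]] := step _ _ FX FY.
      exists (Z `|` P0)%classic; split; [exact: Fok|exact: wid| |].
        by left; apply: XZ.
      by left; apply: YZ.
    - by exists (X `|` P0)%classic; split;
        [exact: Fok|exact: wid|left|right].
    - by exists (Y `|` P0)%classic; split;
        [exact: Fok|exact: wid|right|left].
    - by exists P0; split=> // z P0z; right.
  split; first split=> [|a x y Ux Uy]; first by right; case: sub0.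
    by have [X [[[_ sX] _] XU Xx Xy]] := key x y Ux Uy; apply/XU/sX.
  by move=> x Ux; have [X [[_ gX] _ Xx _]] := key x x Ux Ux; apply: gX.
pose P : set B := (A `|` P0)%classic.
have [subP goodP] := okA : ok P.
exists P; split=> // [x P0x|y hy]; first by right.
have [//|nPy] := pselect (P y).
pose P' : set B := fun z => exists2 x, P x & exists r, z = x + r *: y.
have PP' x : P x -> P' x by move=> Px; exists x => //; exists 0; rewrite scale0r addr0.
have P'P0 : (P' `|` P0)%classic = P'.
  by apply/seteqP; split=> z; [case=> // P0z; apply/PP'; right|left].
case: (maxA P'); last first.
  rewrite P'P0; split=> [|_ [x Px [r ->]]]; last exact: hy.
  split=> [|a _ _ [x Px [r ->]] [x' Px' [r' ->]]].
    by exists 0; [case: subP|exists 0; rewrite scale0r addr0].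
  exists (a *: x + x'); first by case: subP => _; apply.
  exists (a * r + r'); rewrite scalerDl scalerDr scalerA.
  by rewrite !addrA; congr (_ + _); rewrite -!addrA; congr (_ + _); rewrite addrC.
split=> [z Az|P'A]; first by apply/PP'; left.
apply: nPy; left; apply: P'A; exists 0; first by case: subP.
by exists 1; rewrite scale1r add0r.
Qed.

End Submodules.

(** A homomorphism from a submodule of [B], kept as its graph: a submodule of [B * E] that meets
    [0 * E] trivially. Its domain then needs no type of its own. *)
Definition linear_graph (S : pzRingType) (B E : lmodType S)
    (G : B -> E -> Prop) : Prop :=
  [/\ G 0 0,
      forall a b e b' e', G b e -> G b' e' -> G (a *: b + b') (a *: e + e') &
      forall e, G 0 e -> e = 0].

Definition baer (S : pzRingType) (E : lmodType S) : Prop :=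
  forall H : S^o -> E -> Prop, linear_graph H ->
  exists e0 : E, forall (a : S) e, H a e -> e = a *: e0.

Section LinearGraph.

Variables (S : pzRingType) (B E : lmodType S) (G : B -> E -> Prop).
Hypothesis linG : linear_graph G.

Lemma linear_graph_scale a b e : G b e -> G (a *: b) (a *: e).
Proof. by case: linG => g0 gl _ /gl/(_ g0) h; have := h a; rewrite !addr0. Qed.

Lemma linear_graph_add b e b' e' : G b e -> G b' e' -> G (b + b') (e + e').
Proof. by case: linG => _ gl _ h h'; have := gl 1 _ _ _ _ h h'; rewrite !scale1r. Qed.

Lemma linear_graph_sub b e b' e' : G b e -> G b' e' -> G (b - b') (e - e').
Proof. by move=> h h'; rewrite -!scaleN1r; apply/linear_graph_add/linear_graph_scale. Qed.

Lemma linear_graph_fun b e e' : G b e -> G b e' -> e = e'.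
Proof.
move=> h h'; have := linear_graph_sub h h'; rewrite subrr.
by case: linG => _ _ g /g/eqP; rewrite subr_eq0 => /eqP.
Qed.

End LinearGraph.

Lemma linear_graph_total (S : pzRingType) (B E : lmodType S) (G : B -> E -> Prop) :
  linear_graph G -> (forall b, exists e, G b e) ->
  exists g : {linear B -> E}, forall b, G b (g b).
Proof.
move=> linG /choice[g Gg].
have lin_g : linear g.
  move=> a x y; apply: (linear_graph_fun linG) (Gg _) _.
  by case: linG => _ h _; apply: h.
pose gl := GRing.isLinear.Build S B E *:%R g lin_g.
by exists (HB.pack_for {linear B -> E} g gl) => b /=.
Qed.

(* Baer's criterion, for an arbitrary submodule of [B] given by the domain of [G]. *)
Lemma baer_extend (S : pzRingType) (B E : lmodType S) (G : B -> E -> Prop) :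
  baer E -> linear_graph G ->
  exists g : {linear B -> E}, forall b e, G b e -> g b = e.
Proof.
move=> baerE [G0 GD Gfun].
have [||P [[P0 PD] GP goodP maxP]] := @maximal_submod _ (B * E)%type
    (fun z => G z.1 z.2) (fun z => z.1 = 0 -> z.2 = 0).
- by split=> // a [b e] [b' e'] /=; apply: GD.
- by move=> [b e] /= h eb; apply: Gfun; rewrite -{1}eb.
pose G' b e := P (b, e).
have linG' : linear_graph G'.
  split=> // [a b e b' e' h h'|e h]; first exact: (PD a (b, e) (b', e')).
  exact: (goodP _ h).
have [b|g Gg] := linear_graph_total linG'; last first.
  exists g => b e /(GP (b, e)) h; exact: linear_graph_fun (Gg b) h.
(* The scalars taking [b] into the domain form an ideal, and Baer's condition on it yields a value
   [e0] for [b]. Adjoining [(b, e0)] keeps the graph single-valued, so maximality puts [b] in the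
   domain. *)
have [|e0 he0] := baerE (fun (a : S) e => G' (a *: b) e).
  split=> [|a c e c' e' h h'|e]; first by rewrite scale0r; case: linG'.
    by rewrite scalerDl -scalerA; case: linG' => _ + _; apply.
  by rewrite scale0r; case: linG' => _ _; apply.
exists e0; apply: maxP => -[x e] r Px /= /eqP; rewrite addr_eq0 -scaleNr => /eqP xE.
have /he0 -> : G' (- r *: b) e by rewrite -xE.
by rewrite scaleNr addNr.
Qed.

Lemma baer_injective (S : pzRingType) (E : lmodType S) : baer E -> injective_module E.
Proof.
move=> baerE A B i f inj_i.
have [|g hg] := @baer_extend S B E (fun b e => exists2 a, b = i a & e = f a) baerE.
  split=> [|c _ _ _ _ [a -> ->] [a' -> ->]|e [a /esym]].
  - by exists 0; rewrite raddf0.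
  - by exists (c *: a + a'); rewrite linearP.
  - by rewrite -(raddf0 i) => /inj_i-> ->; rewrite raddf0.
by exists g => a; apply: hg; exists a.
Qed.

Lemma injective_baer (S : pzRingType) (E : lmodType S) : injective_module E -> baer E.
Proof.
move=> injE H linH.
have subD : is_submod (fun a : S^o => exists e, H a e).
  split; first by exists 0; case: linH.
  by move=> a x y [e h] [e' h']; exists (a *: e + e'); case: linH => _ + _; apply.
pose D := submod_of (submod_pred subD).
have [||f Hf] := @linear_graph_total S D E (fun x e => H (val x) e).
- case: linH => H0 HD H1; split.
  + by rewrite raddf0.
  + by move=> a b e b' e'; rewrite linearP; apply: HD.
  + by move=> e; rewrite raddf0; apply: H1.
- by move=> x; exact: (proj1 (submod_predE subD _) (valP x)).
have [g hg] := injE D S^o val f val_inj.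
exists (g 1) => a e h.
have Da : a \in submod_pred subD by apply/asboolP; exists e.
pose x : D := exist _ a Da.
have -> : e = f x by apply: (linear_graph_fun linH h); exact: (Hf x).
rewrite -(hg x) -linearZ; congr (g _).
by rewrite /GRing.scale /= mulr1.
Qed.

(** * Divisible groups *)


Lemma int_ideal (P : int^o -> Prop) : is_submod P ->
  exists d : nat, forall k : int, P k <-> (d %| k)%Z.
Proof.
move=> subP.
have mulP (a b : int) : P a -> P (b * a) by exact: (@is_submodZ _ int^o).
have [[n [n_gt0 Pn]]|nP] := pselect (exists n : nat, (0 < n)%N /\ P n%:Z); last first.
  exists 0%N => k; rewrite dvd0z; split=> [Pk|/eqP->]; last by case: subP.
  apply/eqP; apply: contrapT => /eqP k_neq0; apply: nP; exists `|k|%N.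
  by rewrite absz_gt0 k_neq0; split=> //; rewrite abszEsg; apply: mulP.
pose p m := (0 < m)%N && `[< P m%:Z >].
have exp : exists m, p m by exists n; rewrite /p n_gt0; apply/asboolP.
case: (ex_minnP exp) => d /andP[d_gt0 /asboolP Pd] min_d.
exists d => k; split=> [Pk|/dvdzP[q ->]]; last exact: mulP.
apply/dvdz_mod0P; apply: contrapT => /eqP r_neq0.
have r_ge0 : 0 <= (k %% d)%Z by apply: modz_ge0; rewrite gt_eqF // ltz_nat.
have r_lt : (k %% d)%Z < d by apply: ltz_pmod; rewrite ltz_nat.
have Pr : P (k %% d)%Z.
  by rewrite /modz; apply: (@is_submodB _ int^o) => //; apply: mulP.
case E : (k %% d)%Z r_ge0 => [r|//] _; rewrite E in r_neq0 r_lt Pr.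
have /min_d : p r by rewrite /p lt0n r_neq0; apply/asboolP.
by rewrite leqNgt -ltz_nat r_lt.
Qed.

Definition divisible (D : zmodType) : Prop :=
  forall (n : nat) (y : D), (0 < n)%N -> exists z, z *+ n = y.

(** The domain is generated by some [d], so it suffices to divide the value at [d] by [d]; when
    [d = 0] that value is 0. *)
Lemma divisible_baer (D : zmodType) : divisible D -> baer (zmodule D : lmodType int).
Proof.
move=> divD H linH; have [H0 HD H1] := linH.
have [|d hd] := @int_ideal (fun a => exists e, H a e).
  split; first by exists 0.
  by move=> a x y [e h] [e' h']; exists (a *: e + e'); apply: HD.
have [e he] : exists e, H d e by apply/hd.
have [e0 e0d] : exists e0 : D, e0 *+ d = e.
  case: (posnP d) => [d0|]; last exact: divD.
  by exists 0; rewrite mul0rn; apply/esym/H1; move: he; rewrite d0.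
exists e0 => a e' h'; have /dvdzP[q aE] : (d %| a)%Z by apply/hd; exists e'.
have h : H a (q *: e).
  by rewrite aE; apply: (linear_graph_scale linH q he).
rewrite (linear_graph_fun linH h' h) aE -[RHS]scalerA; congr (_ *: _).
by rewrite -e0d.
Qed.

Definition integral_rat : {pred rat} := fun x => x \is a Num.int.

Fact integral_rat_closed : zmod_closed integral_rat.
Proof. by split=> [|x y]; rewrite /in_mem /= /integral_rat ?rpred0 //; apply: rpredB. Qed.
HB.instance Definition _ := GRing.isZmodClosed.Build rat integral_rat integral_rat_closed.

Definition rat_mod_int : zmodType := Quotient.quot integral_rat.

Definition ratZ (x : rat) : rat_mod_int :=
  (\pi_(Quotient.quot integral_rat) x)%qT.

Fact ratZ_is_additive : zmod_morphism ratZ.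
Proof. by move=> x y; rewrite /ratZ raddfB. Qed.
HB.instance Definition _ := GRing.isZmodMorphism.Build rat rat_mod_int ratZ ratZ_is_additive.

Lemma ratZ_eq0 x : (ratZ x == 0) = (x \is a Num.int).
Proof.
by rewrite -(raddf0 ratZ) -[in RHS](subr0 x); apply/esym/(Quotient.idealrBE integral_rat).
Qed.

Lemma ratZ_surj y : exists x, ratZ x = y.
Proof. by exists (repr y); rewrite /ratZ reprK. Qed.

Lemma divisible_rat_mod_int : divisible rat_mod_int.
Proof.
move=> n y n_gt0; have [x <-] := ratZ_surj y.
exists (ratZ (x / n%:R)); rewrite -raddfMn /=; congr ratZ.
by rewrite -[_ *+ n]mulr_natr mulfVK // pnatr_eq0 -lt0n.
Qed.

Lemma additive_separation (V : zmodType) (x : V) : x != 0 ->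
  exists f : {additive V -> rat_mod_int}, f x != 0.
Proof.
move=> x_neq0.
have [|d hd] := @int_ideal (fun k => x *~ k = 0).
  split=> [|a k l /= k0 l0]; first by rewrite mulr0z.
  have -> : a *: k = k * a := mulrC a k.
  by rewrite mulrzDr mulrzA k0 mul0rz l0 add0r.
(* [m] is the order [d] of [x], or 2 if [x] has infinite order. Sending [x] to the class of [1/m] is
   well defined, and that class is nonzero because [m > 1]. *)
have [m m_gt1 dm] : exists2 m : nat, (1 < m)%N & forall k : int, (d %| k)%Z -> (m %| k)%Z.
  case: (ltngtP d 1) => [|d_gt1|d1].
  - by case: d {hd} => // _; exists 2 => // k; rewrite dvd0z => /eqP->.
  - by exists d.
  - by case/eqP: x_neq0; apply/(hd 1); rewrite d1.
have m_neq0 : (m%:R : rat) != 0 by rewrite pnatr_eq0 -lt0n ltnW.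
pose t := ratZ m%:R^-1.
have t_neq0 : t != 0.
  apply/eqP => /eqP; rewrite ratZ_eq0 => /intrP[k /(congr1 ( *%R m%:R))].
  rewrite mulfV // => km.
  have : (m %| 1)%Z.
    by apply/dvdzP; exists k; apply: (@intr_inj rat); rewrite intrM mulrC -km.
  by rewrite dvdz1 /= => /eqP m1; rewrite m1 in m_gt1.
have t0 k : x *~ k = 0 -> t *~ k = 0.
  move=> /hd/dm/dvdzP[q ->]; apply/eqP; rewrite -raddfMz ratZ_eq0.
  by rewrite [q * _]mulrC mulrzA -[_ *~ m]mulrzr mulVf // rpredMz ?rpred1.
have [|g hg] := @baer_extend _ (zmodule V) (zmodule rat_mod_int)
  (fun b e => exists k : int, b = x *~ k /\ e = t *~ k) (divisible_baer divisible_rat_mod_int).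
  split=> [|a b e b' e' [k [-> ->]] [l [-> ->]]|e [k [/esym/t0 -> ->]]] //.
    by exists 0; rewrite !mulr0z.
  by exists (a * k + l); rewrite !mulrzDr mulrC !mulrzA.
have add_g : zmod_morphism (g : V -> rat_mod_int) by move=> u v; apply: (raddfB g).
exists (HB.pack_for {additive V -> rat_mod_int} (g : V -> rat_mod_int)
  (GRing.isZmodMorphism.Build V rat_mod_int g add_g)) => /=.
by rewrite (hg x t) //; exists 1.
Qed.

(** [D] is the product of copies of Q/Z indexed by all homomorphisms from [V] to Q/Z, and [i] is
    evaluation. *)
Lemma divisible_embedding (V : zmodType) : exists (D : zmodType) (i : {additive V -> D}),
  divisible D /\ forall x, i x = 0 -> x = 0.
Proof.
pose D : zmodType := ({additive V -> rat_mod_int} -> rat_mod_int)%type.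
pose i (x : V) : D := fun f => f x.
have add_i : zmod_morphism i by move=> x y; apply/funext => f; rewrite /i raddfB.
exists D, (HB.pack_for {additive V -> D} i (GRing.isZmodMorphism.Build V D i add_i)).
split=> [n y n_gt0|x /= ix0].
  have [z zy] := choice (fun f => divisible_rat_mod_int (y f) n_gt0).
  exists z; apply/funext => f; rewrite -zy.
  by elim: {n_gt0 zy} n => [|n IHn]; rewrite ?mulr0n ?mulrS // -IHn.
apply/eqP/negPn/negP => /additive_separation[f]; apply/negP/negPn/eqP.
by have := congr1 (fun h => h f) ix0.
Qed.

(** * Injective hulls *)


Section Coinduced.

Variables (R : comNzRingType) (D : zmodType).

Definition additive_pred : {pred (R -> D)} := fun f => `[< zmod_morphism f >].

Fact additive_pred_closed : zmod_closed additive_pred.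
Proof.
split=> [|f g /asboolP addf /asboolP addg]; apply/asboolP => x y /=.
  by rewrite subr0.
by rewrite -[LHS]/(f (x - y) - g (x - y)) addf addg [X in _ + X]opprD addrACA -opprD.
Qed.
HB.instance Definition _ := GRing.isZmodClosed.Build (R -> D) additive_pred additive_pred_closed.

Definition coinduced := {f : R -> D | f \in additive_pred}.
HB.instance Definition _ := SubChoice.on coinduced.
HB.instance Definition _ := [SubChoice_isSubZmodule of coinduced by <:].

Lemma coinduced_ext (f g : coinduced) : (forall x, val f x = val g x) -> f = g.
Proof. by move=> fg; apply/val_inj/funext. Qed.

Lemma coinducedB (f : coinduced) x y : val f (x - y) = val f x - val f y.
Proof. by have /asboolP := valP f; apply. Qed.

Fact coinduced_scale_subproof (r : R) (f : coinduced) :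
  (fun x => val f (x * r)) \in additive_pred.
Proof. by apply/asboolP => x y /=; rewrite mulrBl coinducedB. Qed.

Definition coinduced_scale (r : R) (f : coinduced) : coinduced :=
  exist _ (fun x => val f (x * r)) (coinduced_scale_subproof r f).

Fact coinduced_scaleA a b f :
  coinduced_scale a (coinduced_scale b f) = coinduced_scale (a * b) f.
Proof. by apply: coinduced_ext => x /=; rewrite mulrA. Qed.

Fact coinduced_scale1 : left_id 1 coinduced_scale.
Proof. by move=> f; apply: coinduced_ext => x /=; rewrite mulr1. Qed.

Fact coinduced_scaleDr : right_distributive coinduced_scale +%R.
Proof. by move=> r f g; apply: coinduced_ext. Qed.

Fact coinduced_scaleDl f : {morph coinduced_scale^~ f : a b / a + b}.
Proof.
move=> a b; apply: coinduced_ext => x.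
transitivity (val f (x * a - - (x * b))); first by rewrite opprK -mulrDr.
have f0 : val f 0 = 0 by rewrite -[X in val f X](subrr 0) coinducedB subrr.
by rewrite coinducedB -[- (x * b)]sub0r coinducedB f0 sub0r opprK.
Qed.

HB.instance Definition _ := GRing.Zmodule_isLmodule.Build R coinduced
  coinduced_scaleA coinduced_scale1 coinduced_scaleDr coinduced_scaleDl.

(** Evaluation at 1 turns an [R]-linear map into [coinduced] into an additive map into [D]. The
    latter extends to all of [R] by divisibility, and the extension is itself the required element
    of [coinduced]. *)
Lemma coinduced_baer : divisible D -> baer coinduced.
Proof.
move=> /divisible_baer baerD H linH; have [H0 HD H1] := linH.
have [|g hg] := @baer_extend _ (zmodule R) (zmodule D)
    (fun a d => exists2 f, H a f & val f 1 = d) baerD.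
  split=> [|a b _ b' _ [f h <-] [f' h' <-]|_ [f /H1-> <-]] //.
    by exists 0.
  exists (a%:~R *: f + f').
    have -> : a *: b + b' = a%:~R *: (b : R^o) + b' by rewrite [a%:~R *: _]mulrzl.
    exact: HD.
  rewrite -[LHS]/(val f (1 * a%:~R) + val f' 1) mul1r; congr (_ + _).
  have add_f : zmod_morphism (val f) by move=> x y; apply: coinducedB.
  pose fa := HB.pack_for {additive R -> D} (val f) (GRing.isZmodMorphism.Build R D (val f) add_f).
  exact: (raddfMz fa a 1).
have add_g : (g : R -> D) \in additive_pred by apply/asboolP => x y; apply: (raddfB g).
exists (exist _ (g : R -> D) add_g) => a f h; apply: coinduced_ext => x.
rewrite [RHS](hg (x * a) (val f x)) //.
exists (x *: f); first exact: (linear_graph_scale linH).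
by rewrite -[LHS]/(val f (1 * x)) mul1r.
Qed.

End Coinduced.

(** [e] is an additive embedding [i] of [R] in a divisible group. Since [r *: e] takes the value
    [i r] at 1, its annihilator is zero. *)
Lemma faithful_baer (R : comNzRingType) : exists (E : lmodType R) (e : E),
  baer E /\ forall r, r *: e = 0 -> r = 0.
Proof.
have [D [i [divD i_inj]]] := divisible_embedding R.
have add_i : (i : R -> D) \in @additive_pred R D by apply/asboolP => x y; apply: raddfB.
exists (coinduced R D), (exist _ (i : R -> D) add_i); split=> [|r re0]; first exact: coinduced_baer.
apply: i_inj; rewrite -[r]mul1r.
exact: (congr1 (fun f : coinduced R D => val f 1) re0).
Qed.

(* The maximal essential extension of [S e] inside [E] is a direct summand: the
   projection killing a complement [K] extends to an endomorphism of [E], whose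
   image is again an essential extension. *)
Lemma injective_hull (S : pzRingType) (E : lmodType S) (e : E) :
  baer E -> exists (M : lmodType S) (i : {linear M -> E}) (e' : M),
  [/\ i e' = e, injective i, baer M &
      forall m : M, m != 0 -> exists r a, r *: m = a *: e' /\ r *: m != 0].
Proof.
move=> baerE.
pose ess (x : E) := x != 0 -> exists r a, r *: x = a *: e /\ r *: x != 0.
have [||P [subP eP essP maxP]] := @maximal_submod _ E (fun x => exists a, x = a *: e) ess.
- split=> [|a _ _ [b ->] [c ->]]; first by exists 0; rewrite scale0r.
  by exists (a * b + c); rewrite scalerDl scalerA.
- by move=> x [a ->] ae0; exists 1, a; rewrite scale1r.
have Pe : P e by apply: eP; exists 1; rewrite scale1r.
have [||K [subK _ KP maxK]] := @maximal_submod _ E (fun x => x = 0) (fun x => P x -> x = 0).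
- by split=> // a _ _ -> ->; rewrite scaler0 addr0.
- by [].
(* The graph of the projection of [P + K] onto [P] along [K], single-valued because [K] meets [P] in
   0. *)
have [|g hg] := @baer_extend _ E E (fun b c => P c /\ K (b - c)) baerE.
  split=> [|a b c b' c' [Pc Kc] [Pc' Kc']|c [Pc]].
  - by rewrite subr0; split; [case: subP|case: subK].
  - split; first by case: subP => _; apply.
    by rewrite opprD addrACA -scalerBr; case: subK => _; apply.
  - by rewrite sub0r => /(is_submodN subK); rewrite opprK => /KP; apply.
have gP x : P x -> g x = x by move=> Px; apply: hg; rewrite subrr; split=> //; case: subK.
have gK x : K x -> g x = 0 by move=> Kx; apply: hg; rewrite subr0; split=> //; case: subP.
have Pg y : P (g y).
  apply: maxP => x r Px; rewrite /ess => nz.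
  have [z zE] : exists z, x + r *: g y = g z.
    by exists (x + r *: y); rewrite linearD linearZ /= (gP x Px).
  have nKz : ~ K z by move=> /gK z0; rewrite zE z0 eqxx in nz.
  (* As [z] lies outside [K], maximality of [K] gives a nonzero element of [P] in [K + S z]. The map
     [g] fixes it and kills its [K]-part, so it is a multiple of [g z]. *)
  have [s [k [Kk Psz sz0]]] : exists s k, [/\ K k, P (k + s *: z) & k + s *: z != 0].
    apply: contrapT => none; apply: nKz; apply: maxK => k s Kk Pks.
    apply: contrapT => /eqP ks0; apply: none; exists s, k; split=> //.
  have gsz : s *: g z = k + s *: z by rewrite -(gP _ Psz) linearD linearZ /= (gK k Kk) add0r.
  have [t [a [tE t0]]] := essP _ Psz sz0.
  by exists (t * s), a; rewrite zE -scalerA gsz.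
pose M := submod_of (submod_pred subP).
have Me : e \in submod_pred subP by apply/asboolP.
have MP (m : M) : P (val m) := proj1 (submod_predE subP _) (valP m).
exists M, (val : {linear M -> E}), (exist _ e Me); split=> //.
(* [M] inherits Baer's condition as a retract of [E]: [g] has values in [P] and fixes [P]. *)
- move=> H [H0 HD H1].
  have [|x hx] := baerE (fun a y => exists2 m, H a m & y = val m).
    split=> [|a b _ b' _ [m h ->] [m' h' ->]|_ [m /H1-> ->]]; last by rewrite raddf0.
      by exists 0; rewrite ?raddf0.
    by exists (a *: m + m'); rewrite ?linearP //; apply: HD.
  have Mgx : g x \in submod_pred subP by apply/asboolP.
  exists (exist _ (g x) Mgx) => a m h; apply: val_inj.
  rewrite linearZ /= -[LHS]gP; last exact: MP.
  by rewrite (hx a (val m)) ?linearZ //; exists m.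
- move=> m m0; have [|r [a [rE r0]]] := essP (val m) (MP m).
    by apply: contra_neq m0 => m0; apply: val_inj; rewrite m0 raddf0.
  exists r, a; split; first by apply: val_inj; rewrite !linearZ.
  by apply: contra_neq r0 => r0; rewrite -linearZ r0 raddf0.
Qed.

(** * Free modules *)


Lemma seq_greatest (T : eqType) (P : T -> T -> Prop) (s : seq T) (x0 : T) :
  (forall x y, P x y \/ P y x) -> (forall x y z, P x y -> P y z -> P x z) ->
  x0 \in s -> exists2 x, x \in s & forall y, y \in s -> P y x.
Proof.
move=> totP trP; elim: s x0 => // a [|b s] IHs x0 _.
  exists a => [|y]; rewrite inE // => /eqP->.
  by case: (totP a a).
have [x xs xmax] := IHs b (mem_head _ _).
have [Pax|Pxa] := totP a x.
  by exists x => [|y]; rewrite in_cons ?xs ?orbT // => /orP[/eqP->|/xmax].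
exists a => [|y]; rewrite in_cons ?eqxx // => /orP[/eqP->|/xmax Pyx]; last exact: trP Pxa.
by case: (totP a a).
Qed.

Section FreeModules.

Variable R : comNzRingType.

Lemma big_uniq_support (F : lmodType R) (s t : seq F) (c : F -> R) :
  uniq s -> uniq t -> {subset s <= t} ->
  \sum_(b <- s) c b *: b = \sum_(b <- t) (if b \in s then c b else 0) *: b.
Proof.
move=> us ut st; under [RHS]eq_bigr do rewrite (fun_if ( *:%R^~ _)) scale0r.
rewrite -big_mkcond -big_filter; apply: perm_big; apply: uniq_perm => //.
  exact: filter_uniq.
by move=> b; rewrite mem_filter andb_idr //; apply: st.
Qed.

Variables (F : lmodType R) (B : F -> Prop).
Hypothesis basisB : basis B.

Lemma basis_uniq_span (x : F) : exists (s : seq F) (c : F -> R),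
  [/\ uniq s, forall b, b \in s -> B b & x = \sum_(b <- s) c b *: b].
Proof.
have [s [c [sB ->]]] := basisB.1 x.
(* A vector occurring several times in [s] has the same coefficient each time, so its multiplicity
   is absorbed there. *)
exists (undup s), (fun b => c b *+ count_mem b s).
split; [exact: undup_uniq|by move=> b; rewrite mem_undup; apply: sB|].
by under [RHS]eq_bigr do rewrite -scalerMnl; rewrite big_undup_iterop_count.
Qed.

Lemma basis_coord_eq (s t : seq F) (c d : F -> R) :
  uniq s -> uniq t -> (forall b, b \in s -> B b) -> (forall b, b \in t -> B b) ->
  \sum_(b <- s) c b *: b = \sum_(b <- t) d b *: b ->
  forall b, b \in s -> c b = if b \in t then d b else 0.
Proof.
move=> us ut sB tB; pose w := undup (s ++ t).
have sw : {subset s <= w} by move=> b bs; rewrite mem_undup mem_cat bs.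
have tw : {subset t <= w} by move=> b bt; rewrite mem_undup mem_cat bt orbT.
have uw : uniq w := undup_uniq _.
rewrite (big_uniq_support _ us uw sw) (big_uniq_support _ ut uw tw) => /eqP.
rewrite -subr_eq0 -sumrB; under eq_bigr do rewrite -scalerBl.
move=> /eqP sum0 b bs.
pose f b := (if b \in s then c b else 0) - (if b \in t then d b else 0).
have wB b' : b' \in w -> B b' by rewrite mem_undup mem_cat => /orP[/sB|/tB].
have /eqP : f b = 0 by apply: (basisB.2 w f uw wB sum0); apply: sw.
by rewrite /f bs subr_eq0 => /eqP.
Qed.

End FreeModules.

Lemma free_rV (R : comNzRingType) k : free_module ('rV[R]_k : lmodType R).
Proof.
exists (fun b => exists j, b = delta_mx 0 j); split=> [x|s c us sB].
  exists [seq delta_mx 0 j | j <- enum 'I_k].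
  exists (fun b : 'rV[R]_k => \sum_j x 0 j * b 0 j); split=> [b /mapP[j _ ->]|]; first by exists j.
  rewrite big_map big_enum /= [LHS]row_sum_delta; apply: eq_bigr => j _.
  congr (_ *: _); rewrite (bigD1 j) //= mxE !eqxx mulr1 big1 ?addr0 // => i ij.
  by rewrite mxE eqxx (negPf ij) mulr0.
move=> /matrixP/(_ 0) sum0 b bs; have [j bE] := sB b bs.
have := sum0 j; rewrite summxE (bigD1_seq b) //= !mxE bE !mxE !eqxx mulr1 -bE.
rewrite big_seq_cond big1 ?addr0 // => b' /andP[b's b'b].
have [i b'E] := sB b' b's; rewrite b'E !mxE eqxx.
case: eqP => [ij|]; last by rewrite mulr0.
by case/eqP: b'b; rewrite b'E bE ij.
Qed.

(** [G] restricted to [N] is the map into the free module; the map back sends the [j]-th basis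
    vector to [y j]. *)
Lemma factors_through_rV (R : comNzRingType) (M : lmodType R) (N : submodClosed M) k
    (y : 'I_k -> M) (G : M -> 'rV[R]_k -> Prop) :
  linear_graph G ->
  (forall x, x \in N -> exists v, G x v /\ x = \sum_j v 0 j *: y j) ->
  inclusion_factors_through_free N.
Proof.
move=> [G0 GD G1] GN.
pose G' (x : submod_of N) v := G (val x) v.
have linG' : linear_graph G'.
  split=> [|a b e b' e'|e]; rewrite /G'.
  - by rewrite raddf0.
  - by rewrite linearP; apply: GD.
  - by rewrite raddf0; apply: G1.
have [|u Gu] := linear_graph_total linG'.
  by move=> x; have [v [Gv _]] := GN _ (valP x); exists v.
have lin_v : linear (fun w : 'rV[R]_k => \sum_j w 0 j *: y j).
  move=> a w w'; rewrite scaler_sumr -big_split; apply: eq_bigr => j _ /=.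
  by rewrite !mxE scalerDl scalerA.
pose v := HB.pack_for {linear 'rV[R]_k -> M} (fun w : 'rV[R]_k => \sum_j w 0 j *: y j)
  (GRing.isLinear.Build R 'rV[R]_k M *:%R _ lin_v).
exists ('rV[R]_k : lmodType R), u, v; split=> [|x]; first exact: free_rV.
have [w [Gw xE]] := GN _ (valP x).
by rewrite /= (linear_graph_fun linG' (Gu x) Gw) -xE.
Qed.

(** * Valuation rings *)


Definition regular (R : comNzRingType) (a : R) : Prop := forall y, a * y = 0 -> y = 0.

Lemma regular_eltP (R : comNzRingType) (a : R) : a \in @regular_elt R <-> regular a.
Proof.
split=> [/asboolP nz y ay0|reg].
  by apply: contrapT => /eqP y0; apply: nz; exists y.
by apply/asboolP => -[y /eqP y0 /reg].
Qed.

Section ValuationRing.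

Variable R : comNzRingType.
Hypothesis valR : valuation_ring R.

Lemma valuation_dvd (a b : R) : (exists t, b = t * a) \/ (exists t, a = t * b).
Proof.
have sub (c : R) : is_submod (fun x : R^o => exists t, x = t * c).
  split=> [|r _ _ [t ->] [u ->]]; first by exists 0; rewrite mul0r.
  by exists (r * t + u); rewrite mulrDl -mulrA.
have memP c x : reflect (exists t, x = t * c) (x \in submod_pred (sub c)).
  exact: asboolP.
have mem1 c : c \in submod_pred (sub c) by apply/memP; exists 1; rewrite mul1r.
case: (valR (submod_pred (sub a)) (submod_pred (sub b))) => h.
  by right; apply/memP/h.
by left; apply/memP/h.
Qed.

Lemma valuation_annihilators (M : lmodType R) (x y : M) :
  (forall r : R, r *: x = 0 -> r *: y = 0) \/ (forall r : R, r *: y = 0 -> r *: x = 0).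
Proof.
have sub (z : M) : is_submod (fun r : R^o => r *: z = 0).
  split=> [|r a b a0 b0]; first by rewrite scale0r.
  by rewrite scalerDl -scalerA a0 scaler0 b0 addr0.
have memP z r : reflect (r *: z = 0) (r \in submod_pred (sub z)) by exact: asboolP.
by case: (valR (submod_pred (sub x)) (submod_pred (sub y))) => h; [left|right];
  move=> r /memP/h/memP.
Qed.

(** Let [y] kill [t]. If [y] divides [b], then [t * b = 0] and the hypothesis at 1 gives [b = 0].
    Otherwise [y = z * b] and the hypothesis at [z] gives [y = 0]. *)
Lemma regular_of_annihilator (t b : R) :
  b != 0 -> (forall y, y * (t * b) = 0 -> y * b = 0) -> regular t.
Proof.
move=> /eqP b0 ann y ty0; apply: contrapT => y0.
have [[z bE]|[z yE]] := valuation_dvd y b.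
  apply: b0; rewrite -[b]mul1r; apply: ann.
  by rewrite mul1r bE mulrCA ty0 mulr0.
by apply: y0; rewrite yE; apply: ann; rewrite mulrCA -yE.
Qed.

(** Only one inclusion between the annihilators of [m] and [c] is required; the other follows from
    [m = c *: m']. *)
Definition unit_content (M : lmodType R) : Prop :=
  forall m : M, exists (c : R) (m' : M), m = c *: m' /\ forall r, r *: m = 0 -> r * c = 0.

Lemma seq_gcd (T : eqType) (c : T -> R) (s : seq T) x0 : x0 \in s ->
  exists2 x, x \in s & exists t, forall y, y \in s -> c y = t y * c x.
Proof.
move=> x0s; have [||x xs xP] := @seq_greatest _ (fun y x => exists t, c y = t * c x) _ x0 _ _ x0s.
- by move=> x y; have [] := valuation_dvd (c x) (c y); [right|left].
- by move=> x y z [t ->] [u ->]; exists (t * u); rewrite mulrA.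
exists x => //; have /choice[t tP] : forall y, exists t, y \in s -> c y = t * c x.
  by move=> y; case: (boolP (y \in s)) => [/xP[t e]|_]; [exists t|exists 0].
by exists t.
Qed.

(** The factorization goes through [R] itself: [m] goes to [c], which the condition on annihilators
    makes well defined, and 1 goes to [m']. *)
Lemma unit_content_singly (M : lmodType R) : unit_content M -> singly_projective M.
Proof.
move=> ucM N [m mN]; have [c [m' [mE annm]]] := ucM m.
pose G x (v : 'rV[R]_1) := exists r, x = r *: m /\ v = const_mx (r * c).
apply: (@factors_through_rV R M N 1 (fun _ => m') G).
  split=> [|a _ _ _ _ [r [-> ->]] [r' [-> ->]]|_ [r [/esym/annm rc ->]]].
  - by exists 0; rewrite scale0r mul0r; split=> //; apply/matrixP => i j; rewrite !mxE.
  - exists (a * r + r'); split; first by rewrite scalerDl scalerA.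
    by apply/matrixP => i j; rewrite !mxE mulrDl mulrA.
  - by rewrite rc; apply/matrixP => i j; rewrite !mxE.
move=> x /mN[a ->]; exists (const_mx (a * c)); split; first by exists a.
by rewrite big_ord1 mxE -scalerA -mE.
Qed.

(** Among the coordinates of the image of [m] in a free module, one divides all the others. It is
    [c], and [m'] is the image in [M] of the quotient vector. *)
Lemma singly_unit_content (M : lmodType R) : singly_projective M -> unit_content M.
Proof.
move=> spM m.
have subm : is_submod (fun x : M => exists a : R, x = a *: m).
  split=> [|a _ _ [b ->] [c ->]]; first by exists 0; rewrite scale0r.
  by exists (a * b + c); rewrite scalerDl scalerA.
have [|F [u [v [[B basisB] uv]]]] := spM (submod_pred subm).
  by exists m => x; apply: submod_predE.
have mN : m \in submod_pred subm by apply/asboolP; exists 1; rewrite scale1r.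
pose x : submod_of (submod_pred subm) := exist _ m mN.
have [s [c [us sB ux]]] := basis_uniq_span basisB (u x).
have mE : m = v (u x) by rewrite uv.
case: s us sB ux => [|b s] us sB ux.
  exists 0, m; split; last by move=> r; rewrite mulr0.
  by rewrite scale0r mE ux big_nil raddf0.
have [b0 b0s [t tE]] := seq_gcd c (mem_head b s).
exists (c b0), (v (\sum_(y <- b :: s) t y *: y)); split.
  rewrite mE ux -linearZ scaler_sumr; congr (v _).
  by apply: eq_big_seq => y /tE ->; rewrite scalerA mulrC.
move=> r rm; have ru : r *: u x = 0.
  rewrite -linearZ; have -> : r *: x = 0 by apply: val_inj; rewrite linearZ /= rm.
  by rewrite raddf0.
move: ru; rewrite ux scaler_sumr; under eq_bigr do rewrite scalerA.
by move/(basisB.2 _ (fun y => r * c y) us sB); apply.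
Qed.

(** Embed [R e + R x] in a free module and take the coordinate where the entry [c] of [e] divides
    all its entries. Then [c] is regular because [e] has zero annihilator, and relations between [e]
    and [x] are read off there, [d] being the entry of [x]. *)
Lemma finitely_projective_pair (M : lmodType R) (e x : M) :
  finitely_projective M -> (forall r, r *: e = 0 -> r = 0) ->
  exists c d : R, regular c /\ forall a b, b *: e = a *: x -> b * c = a * d.
Proof.
move=> fpM e_free.
have subN : is_submod (fun z : M => exists a b : R, z = a *: e + b *: x).
  split=> [|r _ _ [a [b ->]] [a' [b' ->]]]; first by exists 0, 0; rewrite !scale0r addr0.
  by exists (r * a + a'), (r * b + b'); rewrite !scalerDl scalerDr !scalerA addrACA.
have [|F [u [v [[B basisB] uv]]]] := fpM (submod_pred subN).
  exists [:: e; x] => z; rewrite submod_predE; split.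
    move=> [a [b ->]]; exists (fun i : 'I_2 => if i == ord0 then a else b).
    by rewrite !big_ord_recl big_ord0 /= addr0.
  move=> [c ->]; exists (c ord0), (c (lift ord0 ord0)).
  by rewrite !big_ord_recl big_ord0 /= addr0.
have eN : e \in submod_pred subN.
  by apply/asboolP; exists 1, 0; rewrite scale1r scale0r addr0.
have xN : x \in submod_pred subN.
  by apply/asboolP; exists 0, 1; rewrite scale1r scale0r add0r.
pose e' : submod_of (submod_pred subN) := exist _ e eN.
pose x' : submod_of (submod_pred subN) := exist _ x xN.
have [s [c [us sB ue]]] := basis_uniq_span basisB (u e').
have [s' [d [us' sB' ux]]] := basis_uniq_span basisB (u x').
have ue_free r : r *: u e' = 0 -> r = 0.
  move=> re; apply: e_free; have -> : e = v (u e') by rewrite uv.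
  by rewrite -linearZ re raddf0.
case: s us sB ue => [|b s] us sB ue.
  have /eqP : (1 : R) = 0 by apply: ue_free; rewrite ue big_nil scaler0.
  by rewrite oner_eq0.
have [b0 b0s [t tE]] := seq_gcd c (mem_head b s).
exists (c b0), (if b0 \in s' then d b0 else 0); split=> [r cr|a r re].
  apply: ue_free; rewrite ue scaler_sumr big_seq big1 // => y /tE ->.
  by rewrite scalerA mulrCA mulrC [r * _]mulrC cr mul0r scale0r.
have {}re : r *: u e' = a *: u x'.
  by rewrite -!linearZ; congr (u _); apply: val_inj; rewrite !linearZ.
have scale_sum a' (w : seq F) (f : F -> R) :
    a' *: \sum_(y <- w) f y *: y = \sum_(y <- w) (a' * f y) *: y.
  by rewrite scaler_sumr; apply: eq_bigr => y _; rewrite scalerA.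
move: re; rewrite ue ux !scale_sum.
move/(basis_coord_eq (c := fun y => r * c y) (d := fun y => a * d y)
  basisB us us' sB sB')/(_ _ b0s).
by case: ifP => // _; rewrite mulr0.
Qed.

End ValuationRing.

(** * The total quotient ring as a ring and as an [R]-module *)

Section TotalQuotient.

Variable R : comNzRingType.

Definition tq (a : R) : total_quotient_ring R :=
  loc_frac a (loc_one (@regular_elt R : mulrClosed R)).

Lemma loc_frac_eq (S : mulrClosed R) (a b : R) (s t : loc_denom S) :
  a * loc_val t = b * loc_val s -> loc_frac a s = loc_frac b t.
Proof. by move=> e; apply/loc_fracP; exists 1; rewrite ?rpred1 ?e. Qed.

Fact tq_is_additive : zmod_morphism tq.
Proof.
move=> a b; rewrite -[RHS]/(loc_add (tq a) (loc_opp (tq b))) /tq loc_oppE loc_addE.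
by apply: loc_frac_eq; rewrite /= !mulr1.
Qed.

Fact tq_is_multiplicative : monoid_morphism tq.
Proof.
split=> // a b; rewrite -[RHS]/(loc_mul (tq a) (tq b)) /tq loc_mulE.
by apply: loc_frac_eq; rewrite /= !mulr1.
Qed.

HB.instance Definition _ := GRing.isZmodMorphism.Build R (total_quotient_ring R) tq tq_is_additive.
HB.instance Definition _ :=
  GRing.isMonoidMorphism.Build R (total_quotient_ring R) tq tq_is_multiplicative.

Lemma tq_eq0 a : tq a = 0 -> a = 0.
Proof.
rewrite -[0](raddf0 tq) => /loc_fracP[w /regular_eltP w_reg]; rewrite /= mul0r mulr0 mulr1.
exact: w_reg.
Qed.

Lemma tq_inj : injective tq.
Proof. by move=> a b ab; apply/subr0_eq/tq_eq0; rewrite raddfB /= ab subrr. Qed.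

Lemma tq_frac (q : total_quotient_ring R) : exists a s, regular s /\ tq s * q = tq a.
Proof.
elim/loc_fracW: q => a s; exists a, (loc_val s); split.
  exact/regular_eltP/loc_valP.
rewrite -[LHS]/(loc_mul (tq (loc_val s)) (loc_frac a s)) /tq loc_mulE.
by apply: loc_frac_eq; rewrite /= mulr1 mul1r mulrC.
Qed.

Lemma tq_inv s : regular s -> exists p, p * tq s = 1.
Proof.
move=> /regular_eltP s_reg; exists (loc_frac 1 (LocDenom s_reg)).
rewrite -[LHS]/(loc_mul (loc_frac 1 (LocDenom s_reg)) (tq s)) /tq loc_mulE.
by apply: loc_frac_eq; rewrite /= !mul1r !mulr1.
Qed.

Lemma tq_regular s q : regular s -> tq s * q = 0 -> q = 0.
Proof. by move=> /tq_inv[p ps] sq; rewrite -[q]mul1r -ps -mulrA sq mulr0. Qed.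

Lemma tq_cancel s q q' : regular s -> tq s * q = tq s * q' -> q = q'.
Proof.
move=> s_reg /eqP; rewrite -subr_eq0 -mulrBr => /eqP/(tq_regular s_reg)/eqP.
by rewrite subr_eq0 => /eqP.
Qed.

Lemma regularM (a b : R) : regular a -> regular b -> regular (a * b).
Proof. by move=> ra rb y; rewrite -mulrA => /ra/rb. Qed.

(** For [q = a/s] and [q' = b/t], the comparison is that of [a * t] and [b * s] in [R]. *)
Lemma tq_dvd (q q' : total_quotient_ring R) : valuation_ring R ->
  (exists r, q = tq r * q') \/ (exists r, q' = tq r * q).
Proof.
move=> valR; have [a [s [rs qE]]] := tq_frac q; have [b [t [rt q'E]]] := tq_frac q'.
have key r : a * t = r * (b * s) -> q = tq r * q'.
  move=> /(congr1 tq); rewrite !rmorphM /= -qE -q'E => e.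
  apply: (tq_cancel (regularM rs rt)); rewrite rmorphM /=.
  by rewrite mulrAC e; ring.
have key' r : b * s = r * (a * t) -> q' = tq r * q.
  move=> /(congr1 tq); rewrite !rmorphM /= -qE -q'E => e.
  apply: (tq_cancel (regularM rs rt)); rewrite rmorphM /=.
  by rewrite -mulrA [tq s * _]mulrC e; ring.
have [[r e]|[r e]] := valuation_dvd valR (a * t) (b * s).
  by right; exists r; apply: key'.
by left; exists r; apply: key.
Qed.

(** A separate name for [Q], carrying the scalar action of [R] by restriction along [tq]. *)
Definition tq_module : Type := total_quotient_ring R.
HB.instance Definition _ := GRing.Zmodule.on tq_module.

Definition tq_scale (a : R) (q : tq_module) : tq_module := (tq a * q : total_quotient_ring R).

Fact tq_scaleA a b q : tq_scale a (tq_scale b q) = tq_scale (a * b) q.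
Proof. by rewrite /tq_scale mulrA -rmorphM. Qed.

Fact tq_scale1 : left_id 1 tq_scale.
Proof. by move=> q; rewrite /tq_scale rmorph1 mul1r. Qed.

Fact tq_scaleDr : right_distributive tq_scale +%R.
Proof. by move=> a p q; apply: mulrDr. Qed.

Fact tq_scaleDl q : {morph tq_scale^~ q : a b / a + b}.
Proof. by move=> a b; rewrite /tq_scale rmorphD; apply: mulrDl. Qed.

HB.instance Definition _ := GRing.Zmodule_isLmodule.Build R tq_module
  tq_scaleA tq_scale1 tq_scaleDr tq_scaleDl.

End TotalQuotient.


(** * From finite projectivity to self-injectivity of [Q] *)

Lemma essential_unit_content (R : comNzRingType) (M : lmodType R) (e : M) :
  valuation_ring R -> baer M -> (forall r, r *: e = 0 -> r = 0) ->
  (forall m : M, m != 0 -> exists r a, r *: m = a *: e /\ r *: m != 0) ->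
  unit_content M.
Proof.
move=> valR baerM e_free ess m; have [->|m0] := eqVneq m 0.
  by exists 0, 0; split=> [|r _]; rewrite ?scaler0 ?mulr0.
have [r [a [rE /eqP r0]]] := ess m m0.
have ann_dvd s : s *: m = 0 -> exists u, s = u * r.
  move=> sm; have [//|[u rs]] := valuation_dvd valR r s.
  by case: r0; rewrite rs -scalerA sm scaler0.
(* From [r *: m = a *: e], the content of [m] is morally [a / r]. If [a] divides [r], then [m] has
   zero annihilator and is its own unit part. *)
have [[t aE]|[t rta]] := valuation_dvd valR r a; last first.
  exists 1, m; split=> [|s sm]; first by rewrite scale1r.
  have [u sE] := ann_dvd s sm; have ua : u * a = 0.
    by apply: e_free; rewrite -scalerA -rE scalerA -sE.
  by rewrite mulr1 sE rta mulrCA ua mulr0.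
have annt s : s * t = 0 -> s *: m = 0.
  move=> st; have [[u sE]|[u rs]] := valuation_dvd valR r s.
    by rewrite sE -scalerA rE scalerA aE mulrCA mulrC -sE mulrC [t * s]mulrC st scale0r.
  by case: r0; rewrite rE aE rs mulrCA [t * s]mulrC st mulr0 scale0r.
(* The map from the ideal [R t] sending [t] to [m] is well defined by [annt]. Extending it to [R]
   divides [m] by [t]. *)
have [|m' hm'] := baerM (fun z y => exists s, z = s * t /\ y = s *: m).
  split=> [|b _ _ _ _ [s [-> ->]] [s' [-> ->]]|_ [s [/esym/annt sm ->]]] //.
    by exists 0; rewrite mul0r scale0r.
  by exists (b * s + s'); rewrite mulrDl -mulrA scalerDl -scalerA.
exists t, m'; split=> [|s sm].
  by apply: hm'; exists 1; rewrite mul1r scale1r.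
have [u sE] := ann_dvd s sm; apply: e_free.
by rewrite sE -mulrA [r * t]mulrC -aE -scalerA -rE scalerA -sE.
Qed.

Lemma tq_self_injective (R : comNzRingType) : valuation_ring R ->
  (forall M : lmodType R, singly_projective M -> finitely_projective M) ->
  self_injective (total_quotient_ring R).
Proof.
move=> valR sf; apply: baer_injective => H linH; have [H0 HD H1] := linH.
have [E [e0 [baerE e0_free]]] := faithful_baer R.
have [M [i [e [ie _ baerM ess]]]] := injective_hull e0 baerE.
have e_free r : r *: e = 0 -> r = 0.
  by move=> re; apply: e0_free; rewrite -ie -linearZ re raddf0.
(* The part of [H] with both entries in [R], transported to [M] by sending 1 to [e]; [x] induces it
   on its ideal of [R]. *)
have [|x hx] := baerM (fun (a : R) m => exists b : R, H (tq a) (tq b) /\ m = b *: e).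
  split=> [|c a _ a' _ [b [h ->]] [b' [h' ->]]|_ [b [h ->]]].
  - by exists 0; rewrite !raddf0 scale0r.
  - exists (c * b + b'); rewrite scalerDl scalerA; split=> //.
    by rewrite !raddfD /= !rmorphM; apply: HD.
  - by move: h; rewrite raddf0 => /H1/tq_eq0->; rewrite scale0r.
have ucM := essential_unit_content valR baerM e_free ess.
have fpM := sf M (unit_content_singly ucM).
have [c [d [c_reg cd]]] := finitely_projective_pair valR x fpM e_free.
(* The multiplier is [d / c], since [b * c = a * d] whenever [H] relates [a] to [b] in [R]. A
   general pair of [H] is first cleared of denominators. *)
have [p pc] := tq_inv c_reg; exists (p * tq d) => al be h.
have [a [s [s_reg sE]]] := tq_frac al; have [b [t [t_reg tE]]] := tq_frac be.
have {}h : H (tq (t * a)) (tq (s * b)).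
  have := linear_graph_scale linH (tq (s * t)) h.
  rewrite rmorphM /= -![(_ * _) *: _]mulrA tE [tq t * _]mulrC [tq s * (_ * _)]mulrA sE.
  by rewrite [tq a * _]mulrC -!rmorphM.
have /cd/(congr1 (@tq R)) : (s * b) *: e = (t * a) *: x by apply: hx; exists (s * b).
rewrite !rmorphM /= -sE -tE => eq.
apply: (tq_cancel (regularM c_reg (regularM s_reg t_reg))).
rewrite -[al *: _]/(al * (p * tq d)) !rmorphM /=.
transitivity (tq s * (tq t * be) * tq c); first by ring.
rewrite eq; transitivity ((p * tq c) * (tq t * (tq s * al) * tq d)); last by ring.
by rewrite pc mul1r.
Qed.

(** * From self-injectivity of [Q] to finite projectivity *)

Lemma tq_module_baer (R : comNzRingType) :
  self_injective (total_quotient_ring R) -> baer (tq_module R).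
Proof.
move=> /injective_baer baerQ H linH; have [H0 HD H1] := linH.
pose Q := total_quotient_ring R.
(* The extension of [H] to fractions, with [a/s] sent to [h/s] when [H a h]. It is [Q]-linear, so
   self-injectivity applies. *)
have [|q0 hq0] := baerQ (fun al be : Q => exists s a,
    [/\ regular s, tq s * al = tq a & H a (tq s * be : Q)]).
  split=> [|c al be al' be' [s [a [s_reg aE h]]] [s' [a' [s'_reg a'E h']]]|be [s [a [s_reg aE h]]]].
  - exists 1, 0; rewrite rmorph1 raddf0 !mulr0; split=> // y.
    by rewrite mul1r.
  - have [k [u [u_reg kE]]] := tq_frac c.
    exists (u * (s * s')), (k * s' * a + u * s * a'); split.
    + by apply: regularM => //; apply: regularM.
    + rewrite -[c *: al]/(c * al) raddfD /= !rmorphM /= -kE -aE -a'E; ring.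
    + have := linear_graph_add linH (linear_graph_scale linH (k * s') h)
        (linear_graph_scale linH (u * s) h').
      congr (H _ _); rewrite -[c *: be]/(c * be) -![_ *: (_ : tq_module R)]/(tq _ * _ : Q).
      rewrite -[LHS]/(_ + _ : Q) !rmorphM /= -kE; ring.
  - move: aE h; rewrite mulr0 => /esym/tq_eq0-> /H1.
    exact: tq_regular.
exists q0 => a h ah; rewrite [LHS](hq0 (tq a) h) //.
exists 1, a; rewrite rmorph1 !mul1r; split=> // y.
by rewrite mul1r.
Qed.


(** A dual basis valid on [s] only: the functionals may leave [R] elsewhere on [M], but take values
    in [R] on [s]. *)
Definition dual_family (R : comNzRingType) (M : lmodType R) (s : seq M) : Prop :=
  exists (k : nat) (theta : 'I_k -> {linear M -> tq_module R}) (y : 'I_k -> M),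
  forall x, x \in s -> exists a : 'I_k -> R,
    (forall j, theta j x = tq (a j)) /\ x = \sum_j a j *: y j.

Lemma dual_family_factors (R : comNzRingType) (M : lmodType R) (N : submodClosed M) (s : seq M) :
  (forall x, x \in N <-> exists c : 'I_(size s) -> R, x = \sum_i c i *: s`_i) ->
  dual_family s -> inclusion_factors_through_free N.
Proof.
move=> Ns [k [theta [y dual]]].
pose G x (v : 'rV[R]_k) := forall j, theta j x = tq (v 0 j).
have linG : linear_graph G.
  split=> [j|a b v b' v' h h' j|v h].
  - by rewrite raddf0 mxE raddf0.
  - by rewrite linearP h h' !mxE [RHS]raddfD /= rmorphM.
  - by apply/rowP => j; rewrite mxE; apply: tq_eq0; rewrite -h raddf0.
apply: (factors_through_rV linG (y := y)) => x /Ns[c ->].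
pose P z := exists v, G z v /\ z = \sum_j v 0 j *: y j.
apply: (big_ind P).
- by exists 0; split; [case: linG|rewrite big1 // => j _; rewrite mxE scale0r].
- move=> z z' [v [h zE]] [v' [h' z'E]]; exists (v + v'); split.
    exact: (linear_graph_add linG h h').
  by rewrite {1}zE {1}z'E -big_split; apply: eq_bigr => j _; rewrite mxE scalerDl.
move=> i _; have [a [aE sE]] := dual _ (mem_nth 0 (ltn_ord i)).
exists (c i *: \row_j a j); split.
  by apply: (linear_graph_scale linG) => j; rewrite mxE.
by rewrite {1}sE scaler_sumr; apply: eq_bigr => j _; rewrite !mxE scalerA.
Qed.

(* A coordinate [pi], with [pi m2 = 1], whose values on [s] are multiples of
   [c2 = pi x2] in [R], although [pi] need not map [M] into [R]. *)
Lemma unit_coordinate (R : comNzRingType) (M : lmodType R) (s : seq M) (x0 : M) :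
  valuation_ring R -> baer (tq_module R) -> unit_content M -> x0 \in s -> x0 != 0 ->
  exists (pi : {linear M -> tq_module R}) (x2 m2 : M) (c2 : R),
  [/\ x2 \in s, x2 = c2 *: m2, pi m2 = (1 : total_quotient_ring R) &
      forall x, x \in s -> exists a, pi x = tq (a * c2)].
Proof.
move=> valR baerQ ucM x0s /eqP x0_neq0.
(* [x1] has the smallest annihilator among the members of [s]. *)
have [||x1 x1s x1max] := @seq_greatest _
    (fun y x : M => forall r : R, r *: x = 0 -> r *: y = 0) s x0 _ _ x0s.
- by move=> x y; have [] := valuation_annihilators valR x y; [right|left].
- by move=> x y z xy yz r /yz/xy.
have [c [m' [x1E annx1]]] := ucM x1.
have c_neq0 : c != 0.
  apply/eqP => c0; apply: x0_neq0; rewrite -[x0]scale1r; apply: x1max => //.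
  by rewrite scale1r x1E c0 scale0r.
(* Writing [m' = d *: m''], the element [d] is regular by comparison of annihilators, so [m'] can be
   sent to 1 in [Q]. *)
have m'_free r : r *: m' = 0 -> r = 0.
  have [d [m'' [m'E annm']]] := ucM m'.
  move=> /annm'; rewrite mulrC; apply: (regular_of_annihilator valR c_neq0) => y ydc.
  apply: annx1; have -> : y *: x1 = (y * (d * c)) *: m''.
    by rewrite x1E m'E !scalerA; congr (_ *: _); ring.
  by rewrite ydc scale0r.
have [|pi hpi] := @baer_extend _ M (tq_module R)
    (fun b q => exists r, b = r *: m' /\ q = tq r) baerQ.
  split=> [|a _ _ _ _ [r [-> ->]] [r' [-> ->]]|_ [r [/esym/m'_free-> ->]]].
  - by exists 0; rewrite scale0r raddf0.
  - exists (a * r + r'); split; first by rewrite scalerDl scalerA.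
    by rewrite raddfD /= rmorphM.
  - by rewrite raddf0.
have pix1 : pi x1 = tq c by apply: hpi; exists c.
(* [pi x2] generates the [R]-submodule of [Q] spanned by the values of [pi] on [s]. *)
have [||x2 x2s x2max] := @seq_greatest _
    (fun y x : M => exists r, pi y = r *: pi x) s x0 _ _ x0s.
- by move=> x y; have [] := tq_dvd (pi x) (pi y) valR; [left|right].
- by move=> x y z [r ->] [r' ->]; exists (r * r'); rewrite scalerA.
have [c2 [m2 [x2E annx2]]] := ucM x2; have [r0 x1x2] := x2max x1 x1s.
have c2_neq0 : c2 != 0.
  apply/eqP => c20; case/eqP: c_neq0; apply: tq_eq0.
  by rewrite -pix1 x1x2 x2E c20 scale0r raddf0 scaler0.
have [b [t [t_reg tb]]] := tq_frac (pi m2 : total_quotient_ring R).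
(* If [y] kills [b * c2], it kills [pi x2], hence [pi x1 = c], hence [x1], hence [x2], whose
   annihilator is that of [c2]. So [pi m2 = b/t] is a unit of [Q]. *)
have b_reg : regular b.
  apply: (regular_of_annihilator valR c2_neq0) => y ybc; apply: annx2.
  apply: (x1max _ x2s); rewrite x1E scalerA.
  have -> : y * c = 0; last by rewrite scale0r.
  apply: tq_eq0; rewrite rmorphM /= -pix1 x1x2.
  have pix2 : tq y * pi x2 = 0 :> total_quotient_ring R.
    apply: (tq_regular t_reg); rewrite x2E linearZ.
    rewrite -[X in tq y * X]/(tq c2 * pi m2 : total_quotient_ring R).
    transitivity (tq y * tq c2 * (tq t * pi m2) : total_quotient_ring R); first by ring.
    by rewrite tb -!rmorphM -mulrA [c2 * b]mulrC ybc raddf0.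
  by rewrite -[r0 *: _]/(tq r0 * pi x2 : total_quotient_ring R) mulrCA pix2 mulr0.
have [p pb] := tq_inv b_reg.
(* [w] is the inverse of [pi m2], used to normalize the functional. *)
pose w : total_quotient_ring R := p * tq t.
pose g : M -> tq_module R := fun x => (w * pi x : total_quotient_ring R).
have lin_g : linear g.
  by move=> a u v; rewrite /g linearP mulrDr; congr (_ + _); apply: mulrCA.
pose wpi := HB.pack_for {linear M -> tq_module R} g
  (GRing.isLinear.Build R M (tq_module R) *:%R g lin_g).
have wpi_m2 : wpi m2 = (1 : total_quotient_ring R) by rewrite /= /g /w -mulrA tb pb.
exists wpi, x2, m2, c2; split=> // x xs; have [r xE] := x2max x xs.
exists r; rewrite rmorphM.
transitivity (tq r * (tq c2 * wpi m2) : total_quotient_ring R); last first.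
  by rewrite wpi_m2 mulr1.
rewrite -[wpi x]/(w * pi x : total_quotient_ring R) xE x2E linearZ.
rewrite -[r *: _]/(tq r * (tq c2 * pi m2) : total_quotient_ring R).
rewrite -[wpi m2]/(w * pi m2 : total_quotient_ring R); ring.
Qed.

(** Write [y = d *: z] in [M]. If [pi z] is some [r] in [R], then [d * r = 0] and [z - r *: m2]
    replaces [z] inside the kernel. Otherwise [pi z] is a unit of [Q] killed by [d], so [y = 0]. *)
Lemma kernel_unit_content (R : comNzRingType) (M : lmodType R)
    (pi : {linear M -> tq_module R}) (m2 : M) (subK : is_submod (fun x => pi x = 0)) :
  valuation_ring R -> unit_content M -> pi m2 = (1 : total_quotient_ring R) ->
  unit_content (submod_of (submod_pred subK)).
Proof.
move=> valR ucM pim2 y; have [d [z [yE anny]]] := ucM (val y).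
have piy : pi (val y) = 0 := proj1 (submod_predE subK _) (valP y).
have [b [t [t_reg tb]]] := tq_frac (pi z : total_quotient_ring R).
have dpiz : tq d * pi z = 0 :> total_quotient_ring R by rewrite -piy yE linearZ.
have [[r bE]|[r tE]] := valuation_dvd valR t b; last first.
  have d0 : d = 0.
    have b_reg : regular b by move=> u bu; apply: t_reg; rewrite tE -mulrA bu mulr0.
    apply: b_reg; rewrite mulrC; apply: tq_eq0.
    by rewrite rmorphM /= -tb mulrCA dpiz mulr0.
  exists 0, y; split=> [|u _]; last by rewrite mulr0.
  by apply: val_inj; rewrite yE d0 !scale0r raddf0.
have pizE : pi z = tq r by apply: (tq_cancel t_reg); rewrite tb bE rmorphM mulrC.
have dr0 : d * r = 0 by apply: tq_eq0; rewrite rmorphM /= -pizE.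
have z'K : z - r *: m2 \in submod_pred subK.
  have pirm2 : pi (r *: m2) = tq r by rewrite linearZ pim2; exact: mulr1.
  by apply/asboolP; rewrite linearB pirm2 pizE subrr.
exists d, (exist _ (z - r *: m2) z'K); split=> [|u uy].
  by apply: val_inj; rewrite linearZ /= scalerBr scalerA dr0 scale0r subr0.
by apply: anny; rewrite -linearZ uy raddf0.
Qed.

Lemma dual_family_exists (R : comNzRingType) (M : lmodType R) (s : seq M) :
  valuation_ring R -> baer (tq_module R) -> unit_content M -> dual_family s.
Proof.
move=> valR baerQ; have [n] := ubnP (size s); elim: n M s => // n IHn M s /ltnSE size_s ucM.
have [/allP s0|/allPn[x0 x0s x0_neq0]] := boolP (all (pred1 (0 : M)) s).
  exists 0%N, (fun=> \0), (fun=> 0) => x /s0/eqP->; exists (fun=> 0).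
  by rewrite big_ord0; split=> // -[].
have [pi [x2 [m2 [c2 [x2s x2E pim2 pis]]]]] := unit_coordinate valR baerQ ucM x0s x0_neq0.
have pi_scale r : pi (r *: m2) = tq r.
  by rewrite linearZ pim2; exact: mulr1.
have subK : is_submod (fun x => pi x = 0).
  by split=> [|a x y px py]; rewrite ?raddf0 // linearP px py scaler0 addr0.
pose K := submod_of (submod_pred subK).
have ucK : unit_content K := kernel_unit_content valR ucM pim2.
have /choice[f fP] x : exists ax : R * K,
    x \in s -> pi x = tq ax.1 /\ x = ax.1 *: m2 + val ax.2.
  have [/pis[a pix]|_] := boolP (x \in s); last by exists (0, 0).
  have xK : x - (a * c2) *: m2 \in submod_pred subK.
    by apply/asboolP; rewrite linearB /= pix pi_scale subrr.
  by exists (a * c2, exist _ (x - (a * c2) *: m2) xK : K) => _; rewrite /= addrC subrK.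
(* One occurrence of [x2] is dropped because its residue vanishes, which makes the induction go
   down. *)
have [|k [theta [y dual]]] := IHn K [seq (f x).2 | x <- rem x2 s] _ ucK.
  by rewrite size_map size_rem //; case: (s) x2s size_s.
(* [R m2 + K] is a direct sum but may be smaller than [M]. Extending [theta j] by 0 on [m2], and
   then to [M], uses injectivity of [Q] over [R]. *)
have /choice[Theta ThetaP] j : exists Th : {linear M -> tq_module R},
    forall r (z : K), Th (r *: m2 + val z) = theta j z.
  have [|Th hTh] := @baer_extend _ M (tq_module R)
      (fun b q => exists r (z : K), b = r *: m2 + val z /\ q = theta j z) baerQ.
    split=> [|a _ _ _ _ [r [z [-> ->]]] [r' [z' [-> ->]]]|_ [r [z [e ->]]]].
    - by exists 0, 0; rewrite scale0r !raddf0 addr0.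
    - exists (a * r + r'), (a *: z + z'); split; last by rewrite [RHS]linearP.
      by rewrite [val (_ + _)]linearP scalerDr scalerDl scalerA addrACA.
    - have piz : pi (val z) = 0 := proj1 (submod_predE subK _) (valP z).
      have /tq_eq0 r0 : tq r = 0 by rewrite -pi_scale -[LHS]addr0 -piz -raddfD -e raddf0.
      have -> : z = 0 by apply: val_inj; move: e; rewrite r0 scale0r add0r.
      by rewrite raddf0.
  by exists Th => r z; apply: hTh; exists r, z.
exists k.+1, (fun j => if unlift ord0 j is Some i then Theta i else pi).
exists (fun j => if unlift ord0 j is Some i then val (y i) else m2) => x xs.
have [pix xE] := fP x xs.
have [a [thetaE f2E]] : exists a : 'I_k -> R,
    (forall j, theta j (f x).2 = tq (a j)) /\ (f x).2 = \sum_j a j *: y j.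
  (* Other members of [s] survive in the shortened list; for [x2] all coordinates after the first
     are 0. *)
  have [x_x2|x_x2] := eqVneq x x2; last first.
    apply: dual; apply: map_f; move: xs; rewrite (perm_mem (perm_to_rem x2s)) in_cons.
    by rewrite (negPf x_x2).
  have f20 : (f x).2 = 0.
    have f1 : (f x).1 = c2 by apply: tq_inj; rewrite -pix x_x2 x2E pi_scale.
    apply: val_inj; apply: (addrI ((f x).1 *: m2)).
    by rewrite -xE f1 x_x2 x2E raddf0 addr0.
  exists (fun=> 0); split=> [j|]; first by rewrite f20 !raddf0.
  by rewrite f20 big1 // => j _; rewrite scale0r.
exists (fun j => if unlift ord0 j is Some i then a i else (f x).1); split=> [j|].
  by case: unliftP => [i _|_]; rewrite ?pix // -thetaE {1}xE ThetaP.
rewrite big_ord_recl unlift_none; under eq_bigr do rewrite liftK.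
rewrite {1}xE f2E raddf_sum; congr (_ + _); apply: eq_bigr => j _.
Qed.

Theorem corollary4p8 (R : comNzRingType) (hR : valuation_ring R) :
  self_injective (total_quotient_ring R) <->
  (forall M : lmodType R, singly_projective M -> finitely_projective M).
Proof.
split=> [injQ M spM N [s Ns]|]; last exact: tq_self_injective.
apply: (dual_family_factors Ns); apply: dual_family_exists => //.
  exact: tq_module_baer.
exact: singly_unit_content.
Qed.
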